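(* Let $A$ be an $\ell$-controllable complete group system, choose a basis of $A$, and let $\mathcal{R}$ be the resulting set of tensors, with bijection $\alpha:\mathcal{R}\to A$. The set $\mathcal{R}$ with the operation $*$ defined by $\dot{\mathbf{r}}*\ddot{\mathbf{r}}=\bar{\mathbf{r}}$, where $\alpha(\bar{\mathbf{r}})=\alpha(\dot{\mathbf{r}})\alpha(\ddot{\mathbf{r}})$, forms a group $(\mathcal{R},* )$, and $A\simeq(\mathcal{R},* )$ under the bijection $\alpha:\mathcal{R}\to A$.
   Context: Let $(A^t)_{t\in\mathbf{Z}}$ be finite groups. A group system $A$ is a set of sequences $\mathbf{a}=(a^t)_{t\in\mathbf{Z}}$, $a^t\in A^t$, forming a group under componentwise operation, such that every element of $A^t$ occurs as a time-$t$ component, for each $t$. $\chi^t:A\to A^t$ is $\mathbf{a}\mapsto a^t$. $A$ is $\ell$-controllable ($\ell>0$) if for every $t\in\mathbf{Z}$ and all $\dot{\mathbf{a}},\ddot{\mathbf{a}}\in A$ there is $\mathbf{a}\in A$ agreeing with $\dot{\mathbf{a}}$ at all times $<t$ and with $\ddot{\mathbf{a}}$ at all times $\ge t+\ell$. $A$ is complete if every sequence in $\prod_t A^t$ whose restriction to each finite interval is the restriction of some element of $A$ belongs to $A$. $A^{[m,n]}$ is the set of sequences in $A$ that are the identity outside $[m,n]$. $X^t$ (resp. $Y^t$) is the normal subgroup of sequences in $A$ that are the identity at all times $<t$ (resp. $>t$). Basis: for $t\in\mathbf{Z}$, $0\le k\le\ell$ put $\Lambda^{[t,t+k]}=X^{t+1}(X^t\cap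 Y^{t+k})/X^{t+1}(X^t\cap Y^{t+k-1})$. A basis is a choice, for each $(k,t)$, of a transversal $[\Lambda^{[t,t+k]}]$ whose elements (generators $\mathbf{g}^{[t,t+k]}$) lie in $A^{[t,t+k]}$ and in which the trivial coset is represented by the identity sequence. $\mathcal{R}=\prod_{t\in\mathbf{Z}}\prod_{0\le k\le\ell}[\Lambda^{[t,t+k]}]$. The map $\alpha:\mathcal{R}\to A$ sends $\mathbf{r}=(\mathbf{g}^{[t,t+k]})_{k,t}$ to $\prod_{i=+\infty}^{-\infty}\prod_{m=0}^{\ell}\mathbf{g}^{[i,i+m]}$, i.e. the sequence with time-$t$ component $\prod_{j=0}^{\ell}\bigl(\prod_{k=j}^{\ell}\chi^t(\mathbf{g}^{[t-j,t-j+k]})\bigr)$ (factors written left to right in increasing $j$, and increasing $k$ for each $j$); $\alpha$ is a bijection. *)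

(* Defs.v *)
From HB Require Import structures.
From mathcomp Require Import all_boot all_order all_algebra all_fingroup.
From mathcomp Require Import boolp classical_sets functions.

Set Implicit Arguments.
Unset Strict Implicit.
Unset Printing Implicit Defensive.

Import Order.TTheory GRing.Theory Num.Theory.
Local Open Scope ring_scope.
Local Open Scope classical_set_scope.

Definition bisequence (gT : int -> finGroupType) := forall t : int, gT t.

Section BisequenceGroup.
Variable gT : int -> finGroupType.
Implicit Types a b c : bisequence gT.

HB.instance Definition _ := Choice.copy (bisequence gT) (forall t : int, gT t).

Definition bisequence_one : bisequence gT := fun=> 1%g.
Definition bisequence_inv a : bisequence gT := fun t => (a t)^-1%g.
Definition bisequence_mul a b : bisequence gT := fun t => (a t * b t)%g.

Fact bisequence_mulA : associative bisequence_mul.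
Proof. by move=> a b c; apply: functional_extensionality_dep => t; exact: mulgA. Qed.

Fact bisequence_mul1g : left_id bisequence_one bisequence_mul.
Proof. by move=> a; apply: functional_extensionality_dep => t; exact: mul1g. Qed.

Fact bisequence_mulg1 : right_id bisequence_one bisequence_mul.
Proof. by move=> a; apply: functional_extensionality_dep => t; exact: mulg1. Qed.

Fact bisequence_mulVg :
  left_inverse bisequence_one bisequence_inv bisequence_mul.
Proof. by move=> a; apply: functional_extensionality_dep => t; exact: mulVg. Qed.

Fact bisequence_mulgV :
  right_inverse bisequence_one bisequence_inv bisequence_mul.
Proof. by move=> a; apply: functional_extensionality_dep => t; exact: mulgV. Qed.

HB.instance Definition _ := isGroup.Build (bisequence gT)
  bisequence_mulA bisequence_mul1g bisequence_mulg1
  bisequence_mulVg bisequence_mulgV.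

End BisequenceGroup.

Record group_system (gT : int -> finGroupType) := GroupSystem {
  gs_set :> set (bisequence gT);
  gs_group : group_closed [in gs_set];
  gs_onto : forall (t : int) (x : gT t), exists2 a, gs_set a & a t = x
}.

Section Controllability.
Variables (gT : int -> finGroupType) (A : set (bisequence gT)).

Definition controllable (l : nat) : Prop :=
  forall (t : int) (a1 a2 : bisequence gT), A a1 -> A a2 ->
  exists a, [/\ A a, forall s, s < t -> a s = a1 s
                   & forall s, t + l%:Z <= s -> a s = a2 s].

Definition complete : Prop :=
  forall a : bisequence gT,
    (forall m n : int, exists2 b, A b & forall t, m <= t <= n -> b t = a t) ->
  A a.

Definition supported_in (m n : int) : set (bisequence gT) :=
  [set a | A a /\ forall t, ~~ (m <= t <= n) -> a t = 1%g].

Definition Xsub (t : int) : set (bisequence gT) :=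
  [set a | A a /\ forall s, s < t -> a s = 1%g].

Definition Ysub (t : int) : set (bisequence gT) :=
  [set a | A a /\ forall s, t < s -> a s = 1%g].

Definition setmul (S T : set (bisequence gT)) : set (bisequence gT) :=
  [set (x * y)%g | x in S & y in T].

(* The quotient N / H, as the set of its cosets. *)
Definition cosets (N H : set (bisequence gT)) : set (set (bisequence gT)) :=
  [set [set (x * h)%g | h in H] | x in N].

(* For k = 0 the second factor of the denominator is X^t `&` Y^(t-1) = 1. *)
Definition granule (t : int) (k : nat) : set (set (bisequence gT)) :=
  cosets (setmul (Xsub (t + 1)) (Xsub t `&` Ysub (t + k%:Z)))
         (setmul (Xsub (t + 1)) (Xsub t `&` Ysub (t + k%:Z - 1))).

Definition transversal_of (Q : set (set (bisequence gT)))
    (T : set (bisequence gT)) : Prop :=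
  T `<=` \bigcup_(C in Q) C /\ forall C, Q C -> exists! g, T g /\ C g.

Record basis (l : nat) := Basis {
  basis_rep :> int -> 'I_l.+1 -> set (bisequence gT);
  basis_transversal : forall t (k : 'I_l.+1),
    transversal_of (granule t k) (basis_rep t k);
  basis_support : forall t (k : 'I_l.+1),
    basis_rep t k `<=` supported_in t (t + k%:Z);
  basis_one : forall t k, basis_rep t k 1%g
}.

Definition tensor (l : nat) (B : basis l) : Type :=
  forall (t : int) (k : 'I_l.+1), set_type (B t k).

Definition alpha (l : nat) (B : basis l) (r : tensor B) : bisequence gT :=
  fun t => (\prod_(j < l.+1) \prod_(k < l.+1 | (j <= k)%N)
              val (r (t - j%:Z) k) t)%g.

(* The default value r is only taken when no u satisfies the equation, which
   does not happen once alpha is a bijection onto A. *)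
Definition tensor_mul (l : nat) (B : basis l) (r s : tensor B) : tensor B :=
  xget r [set u | alpha u = (alpha r * alpha s)%g].

End Controllability.

Definition forms_group (T : Type) (op : T -> T -> T) : Prop :=
  exists (e : T) (inv : T -> T),
    [/\ associative op, left_id e op, right_id e op,
        left_inverse e inv op & right_inverse e inv op].

(* Main.v *)
(* Completeness puts every alpha(r) in A.  Modulo future and past, i.e. modulo
   X^(i+1) Y^(t-1), the sequence alpha(r) reduces to its block of generators
   starting at time i, provided the earlier blocks are known at times >= t; the
   transversal property then recovers the generators of this block that reach
   time t.  Starting from blocks that end before t, this shows that alpha(r) on
   the times >= m determines every generator starting at or after m.
   Controllability lets one split off blocks from the right of any element of
   X^m, so each element of A agrees on the times >= -n with some alpha(r_n); by
   the previous uniqueness the tensors r_n stabilize, and their limit is a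
   preimage under alpha. *)
Require Import Defs.
From mathcomp Require Import all_boot all_order all_algebra all_fingroup.
From mathcomp Require Import boolp classical_sets functions.
From mathcomp Require Import zify.

Set Implicit Arguments.
Unset Strict Implicit.
Unset Printing Implicit Defensive.

Import Order.TTheory GRing.Theory Num.Theory.
Local Open Scope ring_scope.

Section GroupSystem.
Variables (gT : int -> finGroupType) (A : group_system gT).
Implicit Types (a x y z g h : bisequence gT) (i m n p q s t : int).

(** * Closure of [A] and congruence modulo future and past *)

Lemma bisequence1E t : (1%g : bisequence gT) t = 1%g. Proof. by []. Qed.

Lemma bisequence_mulE x y t : (x * y)%g t = (x t * y t)%g. Proof. by []. Qed.

Lemma bisequence_invE x t : x^-1%g t = (x t)^-1%g. Proof. by []. Qed.

Lemma mem_one : gs_set A 1%g.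
Proof. by case: (gs_group A) => /set_mem. Qed.

Lemma mem_mul x y : gs_set A x -> gs_set A y -> gs_set A (x * y)%g.
Proof.
by move=> Ax Ay; apply/set_mem/(group_closedM (gs_group A)); exact/mem_set.
Qed.

Lemma mem_inv x : gs_set A x -> gs_set A x^-1%g.
Proof.
by move=> Ax; apply/set_mem/(group_closedV (gs_group A)); exact/mem_set.
Qed.

Lemma mem_prod I (r : seq I) (P : pred I) (F : I -> bisequence gT) :
  (forall k, P k -> gs_set A (F k)) -> gs_set A (\prod_(k <- r | P k) F k)%g.
Proof.
move=> AF; elim/big_rec: _ => [|k x Pk Ax]; first exact: mem_one.
exact: mem_mul (AF _ Pk) Ax.
Qed.

Lemma bisequence_prodE I (r : seq I) (P : pred I) (F : I -> bisequence gT) t :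
  (\prod_(k <- r | P k) F k)%g t = (\prod_(k <- r | P k) F k t)%g.
Proof. by elim/big_rec2: _ => // k _ y _ <-. Qed.

(* For x and y in A: x^-1 * y lies in X^p Y^(t-1). *)
Definition glued p t x y :=
  exists z, [/\ gs_set A z, forall s, s < p -> z s = x s & forall s, t <= s -> z s = y s].

Lemma glued_refl p t x : gs_set A x -> glued p t x x.
Proof. by exists x. Qed.

(** Witnesses multiply and invert componentwise, so gluing is a congruence and can be cancelled on
    either side. *)
Lemma glued_mul p t x y x' y' :
  glued p t x y -> glued p t x' y' -> glued p t (x * x')%g (y * y')%g.
Proof.
move=> [z [Az zx zy]] [z' [Az' zx' zy']]; exists (z * z')%g.
split; first exact: mem_mul.
- by move=> s sp; rewrite bisequence_mulE zx// zx'.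
- by move=> s ts; rewrite bisequence_mulE zy// zy'.
Qed.

Lemma glued_inv p t x y : glued p t x y -> glued p t x^-1%g y^-1%g.
Proof.
move=> [z [Az zx zy]]; exists z^-1%g; split; first exact: mem_inv.
- by move=> s sp; rewrite bisequence_invE zx.
- by move=> s ts; rewrite bisequence_invE zy.
Qed.

Lemma glued_mulKg p t x y x' y' : glued p t x y ->
  glued p t (x * x')%g (y * y')%g -> glued p t x' y'.
Proof.
move=> /glued_inv xy /(glued_mul xy).
by rewrite !mulgA !mulVg !mul1g.
Qed.

Lemma glued_mulgK p t x y x' y' : glued p t x' y' ->
  glued p t (x * x')%g (y * y')%g -> glued p t x y.
Proof.
move=> /glued_inv xy' /glued_mul/(_ xy').
by rewrite -!mulgA !mulgV !mulg1.
Qed.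

(** * Ordered infinite products of blocks *)

Section Assembly.
Variable l : nat.
Implicit Types b : int -> bisequence gT.

Definition blocks b :=
  forall i, gs_set A (b i) /\ forall s, ~~ (i <= s <= i + l%:Z) -> b i s = 1%g.

(** The infinite product of the [b i] in decreasing order of [i]. Under [blocks b], only those
    starting in [[t - l, t]] can be nontrivial at time [t]. *)
Definition assemble b : bisequence gT :=
  fun t => (\prod_(j < l.+1) b (t - j%:Z) t)%g.

Definition from p b : int -> bisequence gT := fun i => if p <= i then b i else 1%g.
Definition before p b : int -> bisequence gT := fun i => if p <= i then 1%g else b i.

Lemma from_blocks p b : blocks b -> blocks (from p b).
Proof.
by rewrite /from => bb i; case: ifP => // _; split=> //; exact: mem_one.
Qed.

Lemma before_blocks p b : blocks b -> blocks (before p b).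
Proof.
by rewrite /before => bb i; case: ifP => // _; split=> //; exact: mem_one.
Qed.

Lemma assemble_from_lt p b t : t < p -> assemble (from p b) t = 1%g.
Proof.
by move=> tp; apply: big1 => j _; rewrite /from ifF//; lia.
Qed.

Lemma assemble_before_ge p b t :
  blocks b -> p + l%:Z <= t -> assemble (before p b) t = 1%g.
Proof.
move=> bb pt; apply: big1 => j _; rewrite /before; case: ifP => // ptj.
by apply: (bb _).2; have := ltn_ord j; lia.
Qed.

Lemma assemble_split p b :
  assemble b = (assemble (from p b) * assemble (before p b))%g.
Proof.
apply: functional_extensionality_dep => t.
rewrite bisequence_mulE /assemble.
elim: l.+1 => [|n IHn]; first by rewrite !big_ord0 mulg1.
rewrite !big_ord_recr/= IHn [from p b (t - n%:Z)]/from [before p b (t - n%:Z)]/before.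
case: ifP => ptn; last first.
  by rewrite bisequence1E mulg1 mulgA.
(* Each [j < n] gives a start later than [t - n], so the [before] factors are trivial and the new
   factor moves left past them. *)
suff -> : (\prod_(j < n) before p b (t - j%:Z) t = 1)%g by rewrite bisequence1E !mulg1.
by apply: big1 => j _; rewrite /before ifT//; have := ltn_ord j; lia.
Qed.

Lemma assemble_before_succ i b : blocks b ->
  assemble (before (i + 1) b) = (b i * assemble (before i b))%g.
Proof.
move=> bb; rewrite (assemble_split i); congr (_ * _)%g; last first.
  congr assemble; apply: functional_extensionality_dep => s.
  by rewrite /before; case: ifP => // /negbT si; case: ifP => //; lia.
apply: functional_extensionality_dep => t; rewrite /assemble /from /before.
have [/andP[it til]|out] := boolP (i <= t <= i + l%:Z); last first.
  rewrite (bb i).2//; apply: big1 => j _.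
  case: ifP => // itj; case: ifP => // tji.
  by have -> : t - j%:Z = i by [lia]; exact: (bb i).2.
have jP : (`|t - i| < l.+1)%N by lia.
rewrite (@big_only1 _ _ _ _ (Ordinal jP))//=; last first.
  move=> j jti _; case: ifP => // itj; case: ifP => // tji.
  by case/eqP: jti; apply: val_inj => /=; lia.
have -> : t - `|t - i|%:Z = i by lia.
by rewrite lexx ifF//; lia.
Qed.

(** The factor [z] is the finite product of the blocks starting in [[p - n, p)]. *)
Lemma assemble_before_mod b p (n : nat) : blocks b ->
  exists2 z, gs_set A z &
    assemble (before p b) = (z * assemble (before (p - n%:Z) b))%g.
Proof.
move=> bb; elim: n => [|n [z Az ->]].
  by exists 1%g; [exact: mem_one | rewrite subr0 mul1g].
exists (z * b (p - n.+1%:Z)%R)%g; first exact: mem_mul (bb _).1.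
rewrite -mulgA -assemble_before_succ//; congr (_ * assemble (before _ _))%g; lia.
Qed.

Lemma assemble_mem b : complete A -> blocks b -> gs_set A (assemble b).
Proof.
move=> complA bb; apply: complA => m n.
(* Blocks starting after [n] miss the window, and those left out of [z] start before [m - l], hence
   end before [m]. *)
have [z Az zE] := assemble_before_mod (n + 1) `|(n + 1 + l%:Z - m)%R|%N bb.
have [mn|nm] := lerP m n; last first.
  by exists 1%g => [|t]; [exact: mem_one | lia].
exists z => // t mtn; rewrite (assemble_split (n + 1)) zE.
rewrite !bisequence_mulE assemble_from_lt ?mul1g; last by lia.
by rewrite assemble_before_ge ?mulg1//; lia.
Qed.

(** * Basis generators with a common starting time *)

Section Basis.
Variable B : basis A l.
Implicit Types r : tensor B.

Lemma gen_mem i k g : B i k g -> gs_set A g.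
Proof. by case/basis_support. Qed.

Lemma gen_eq1 i k g s : B i k g -> ~~ (i <= s <= i + k%:Z) -> g s = 1%g.
Proof. by case/basis_support => _; exact. Qed.

(** Gluing puts [h] in the granule coset of [g], and a transversal meets each coset once. *)
Lemma gen_inj i k g h :
  B i k g -> B i k h -> glued (i + 1) (i + k%:Z) g h -> g = h.
Proof.
move=> Bg Bh [z [Az zg zh]].
have [C granC Cg] := (basis_transversal B i k).1 _ Bg.
have [f [_ uniq_f]] := (basis_transversal B i k).2 _ granC.
rewrite -(uniq_f g)// -(uniq_f h)//; split=> //.
have [x _ CE] := granC; move: Cg; rewrite -CE => -[_ [u Xu] [v [Xv Yv] <-] gE].
have [Ag Ah] := (gen_mem Bg, gen_mem Bh).
have [[Au u1] [Av v1]] := (Xu, Xv); have v2 := Yv.2.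
exists (u * v * (g^-1 * h))%g; last by rewrite /= mulgA gE mulgA mulgV mul1g.
(* Conjugation by [v] gives [u v g^-1 h = (u w)(v z^-1 h)], with [u w] in X^(i+1) and [v z^-1 h] in
   X^i & Y^(i+k-1). *)
pose w := (v * (g^-1 * z) * v^-1)%g.
exists (u * w)%g.
  split; first by do !apply: mem_mul => //; exact: mem_inv.
  move=> s si; rewrite /w !(bisequence_mulE, bisequence_invE).
  by rewrite u1// zg// mulVg mulg1 mulgV mulg1.
exists (v * (z^-1 * h))%g; last by rewrite /w !mulgA mulgKV mulgK.
have Avzh : gs_set A (v * (z^-1 * h))%g by do !apply: mem_mul => //; exact: mem_inv.
split; split=> // s si; rewrite !(bisequence_mulE, bisequence_invE).
  rewrite v1// zg; last by lia.
  by rewrite !(gen_eq1 (s := s) Bg, gen_eq1 (s := s) Bh) ?invg1 ?mulg1//; lia.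
by rewrite v2// zh ?mulVg ?mulg1//; lia.
Qed.

(* The hypothesis says that x lies in X^(i+1) (X^i & Y^(i+k)). *)
Lemma gen_exists i (k : 'I_l.+1) x :
  Xsub A i x -> glued (i + 1) (i + k%:Z + 1) x 1%g ->
  exists2 g, B i k g & glued (i + 1) (i + k%:Z) x g.
Proof.
move=> [Ax x1] [z [Az zx z1]].
have Nx : setmul (Xsub A (i + 1)) (Xsub A i `&` Ysub A (i + k%:Z))%classic x.
  exists (x * z^-1)%g.
    split; first by apply: mem_mul => //; exact: mem_inv.
    by move=> s si; rewrite !(bisequence_mulE, bisequence_invE) zx ?mulgV.
  exists z; last by rewrite mulgKV.
  split; split=> // s si; last by apply: z1; lia.
  by rewrite zx ?x1//; lia.
have [g [[Bg [_ [u [Au u1] [v [[Av v1] [_ v2]]] <-] gE] _]]] :=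
  (basis_transversal B i k).2 _ (ex_intro2 _ _ x Nx erefl).
(* Here [g = x u v], where [u] is trivial before [i + 1] and [v] from [i + k] on. *)
exists g => //; exists (x * u)%g; split; first exact: mem_mul.
  by move=> s si; rewrite bisequence_mulE u1 ?mulg1.
move=> s iks; rewrite -gE !bisequence_mulE.
by rewrite v2 ?mulg1//; lia.
Qed.

Lemma gen_prod_mem i (n : nat) (g : nat -> bisequence gT) :
  (n <= l.+1)%N -> (forall k : 'I_l.+1, B i k (g k)) ->
  gs_set A (\prod_(k < n) g k)%g.
Proof.
move=> nl Bg; apply: mem_prod => k _.
exact: gen_mem (Bg (widen_ord nl k)).
Qed.

(** Generators are recovered longest first: from time [i + n] on, those of index below [n] vanish,
    so [gen_inj] identifies the last factor, which is then cancelled. *)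
Lemma gen_prod_inj i t (n : nat) (g h : nat -> bisequence gT) :
  (n <= l.+1)%N -> (forall k : 'I_l.+1, B i k (g k)) ->
  (forall k : 'I_l.+1, B i k (h k)) ->
  glued (i + 1) t (\prod_(k < n) g k)%g (\prod_(k < n) h k)%g ->
  forall k, (k < n)%N -> t <= i + k%:Z -> g k = h k.
Proof.
move=> + Bg Bh; elim: n => // n IHn nl.
rewrite !big_ord_recr/= => gh k; rewrite ltnS leq_eqVlt => kn tik.
have tin : t <= i + n%:Z by case/orP: kn => [/eqP<-//|]; lia.
have prefix1 (f : nat -> bisequence gT) s : (forall k : 'I_l.+1, B i k (f k)) ->
    i + n%:Z <= s -> (\prod_(k < n) f k)%g s = 1%g.
  move=> Bf ins; rewrite bisequence_prodE big1// => j _.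
  rewrite (gen_eq1 (Bf (widen_ord (ltnW nl) j)))//=.
  by have := ltn_ord j; lia.
have gn : g n = h n.
  apply: (gen_inj (Bg (Ordinal nl)) (Bh (Ordinal nl))) => /=.
  have [z [Az zg zh]] := gh.
  apply: (@glued_mulKg _ _ (\prod_(k < n) g k)%g (\prod_(k < n) h k)%g).
    exists (\prod_(k < n) g k)%g; split=> //.
      exact: gen_prod_mem (ltnW nl) Bg.
    by move=> s ins; rewrite !prefix1.
  by exists z; split=> // s ins; apply: zh; lia.
case/orP: kn => [/eqP-> //|kn]; apply: IHn => //; first exact: ltnW.
apply: glued_mulgK gh; rewrite gn; apply: glued_refl.
exact: gen_mem (Bh (Ordinal nl)).
Qed.

(** Splitting off the longest generator on the right shortens the span of [x] modulo X^(i+1) by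
    one. *)
Lemma gen_prod_exists i (n : nat) x :
  (n <= l.+1)%N -> Xsub A i x -> glued (i + 1) (i + n%:Z) x 1%g ->
  exists2 g : nat -> bisequence gT, forall k : 'I_l.+1, B i k (g k) &
    Xsub A (i + 1) (x * (\prod_(k < n) g k)^-1)%g.
Proof.
elim: n x => [|n IHn] x nl Xx.
  rewrite addr0 => -[z [Az zx z1]].
  exists (fun=> 1%g) => [k|]; first exact: basis_one.
  rewrite big_ord0 invg1 mulg1; split; first exact: Xx.1.
  (* At [s = i] the witness [z] equals both [x] and the identity. *)
  by move=> s si; rewrite -zx//; have [/Xx.2|/z1//] := ltrP s i; rewrite -zx.
have -> : i + n.+1%:Z = i + n%:Z + 1 by lia.
move=> /(gen_exists (k := Ordinal nl) Xx)[h Bh xh].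
have Ah := gen_mem Bh.
have [||g Bg Xg] := IHn (x * h^-1)%g (ltnW nl).
- split; first by apply: mem_mul (mem_inv _) => //; exact: Xx.1.
  move=> s si; rewrite !(bisequence_mulE, bisequence_invE) (Xx.2 _ si).
  by rewrite (gen_eq1 Bh) ?invg1 ?mulg1//; lia.
- rewrite -[1%g](mulgV h); apply: glued_mul xh _.
  by apply: glued_refl; exact: mem_inv.
exists (fun k => if k == n then h else g k) => [k|].
  case: eqP => [kn|_]; last exact: Bg.
  by have -> : k = Ordinal nl by apply: val_inj.
rewrite big_ord_recr/= eqxx invgM mulgA.
under eq_bigr => k _ do rewrite ltn_eqF ?ltn_ord//.
exact: Xg.
Qed.

(** * Tensors as families of blocks *)

Definition block (r : tensor B) i : bisequence gT :=
  (\prod_(k < l.+1) val (r i k))%g.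

Lemma tensorP (r : tensor B) i k : B i k (val (r i k)).
Proof. exact: set_valP. Qed.

Lemma block_blocks r : blocks (block r).
Proof.
move=> i; split; first by apply: mem_prod => k _; exact: gen_mem (tensorP r i k).
move=> s out; rewrite /block bisequence_prodE big1// => k _.
by rewrite (gen_eq1 (tensorP r i k))//; have := ltn_ord k; lia.
Qed.

(** The generators with [k < j] that [alpha] omits end at [t - j + k < t], so restoring them changes
    nothing. *)
Lemma alphaE r : alpha r = assemble (block r).
Proof.
apply: functional_extensionality_dep => t; apply: eq_bigr => j _.
rewrite /block bisequence_prodE; apply: big_rmcond => k kj.
by rewrite (gen_eq1 (tensorP r (t - j%:Z) k))//; lia.
Qed.

Lemma block_inj r r' i t :
  glued (i + 1) t (block r i) (block r' i) ->
  forall k : 'I_l.+1, t <= i + k%:Z -> r i k = r' i k.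
Proof.
pose gens (u : tensor B) (k : nat) := val (u i (inord k)).
have blockE u : block u i = (\prod_(k < l.+1) gens u k)%g.
  by apply: eq_bigr => k _; rewrite /gens inord_val.
have Bgens u (k : 'I_l.+1) : B i k (gens u k).
  by rewrite /gens inord_val; exact: tensorP.
rewrite !blockE => rs k tik; apply: val_inj.
have := gen_prod_inj (leqnn _) (Bgens r) (Bgens r') rs (ltn_ord k) tik.
by rewrite /gens inord_val.
Qed.

Lemma alpha_split r i : alpha r =
  (assemble (from (i + 1) (block r)) *
    (block r i * assemble (before i (block r))))%g.
Proof.
by rewrite alphaE (assemble_split (i + 1)) assemble_before_succ//; exact: block_blocks.
Qed.

(** * Injectivity of [alpha] *)

Hypothesis complA : complete A.

Lemma alpha_mem r : gs_set A (alpha r).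
Proof. by rewrite alphaE; apply: assemble_mem => //; exact: block_blocks. Qed.

(** In [alpha_split] the futures are glued because they are trivial before [i + 1], the pasts
    because they agree from [t] on; both cancel. *)
Lemma block_glued r r' i t :
  (forall u, t <= u -> alpha r u = alpha r' u) ->
  (forall u, t <= u -> assemble (before i (block r)) u =
                       assemble (before i (block r')) u) ->
  glued (i + 1) t (block r i) (block r' i).
Proof.
move=> rs past.
have future : glued (i + 1) t (assemble (from (i + 1) (block r)))
                              (assemble (from (i + 1) (block r'))).
  exists (assemble (from (i + 1) (block r'))); split=> //.
    by apply: assemble_mem => //; exact/from_blocks/block_blocks.
  by move=> u ui; rewrite !assemble_from_lt.
have past' : glued (i + 1) t (assemble (before i (block r)))
                             (assemble (before i (block r'))).
  exists (assemble (before i (block r))); split=> //.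
  by apply: assemble_mem => //; exact/before_blocks/block_blocks.
apply: (glued_mulgK past'); apply: (glued_mulKg future).
rewrite -!alpha_split; exists (alpha r); split=> //; exact: alpha_mem.
Qed.

Lemma past_eq r r' t (n : nat) :
  (forall u, t <= u -> alpha r u = alpha r' u) -> (n <= l)%N ->
  forall u, t <= u -> assemble (before (t - l%:Z + n%:Z) (block r)) u =
                      assemble (before (t - l%:Z + n%:Z) (block r')) u.
Proof.
move=> rs; elim: n => [|n IHn] nl u tu.
  by rewrite !assemble_before_ge//; try exact: block_blocks; lia.
have -> : t - l%:Z + n.+1%:Z = t - l%:Z + n%:Z + 1 by lia.
set i := t - l%:Z + n%:Z in IHn *.
have past := IHn (ltnW nl).
rewrite !assemble_before_succ; try exact: block_blocks.
rewrite !bisequence_mulE past//; congr (_ * _)%g.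
rewrite /block !bisequence_prodE; apply: eq_bigr => k _.
(* A generator reaching [t] is determined by [block_inj]; a shorter one is trivial at [u]. *)
have [tik|ikt] := lerP t (i + k%:Z).
  by rewrite (block_inj (block_glued rs past) tik).
by rewrite (gen_eq1 (tensorP r i k)) ?(gen_eq1 (tensorP r' i k))//; lia.
Qed.

Lemma tensor_eq_from r r' m :
  (forall u, m <= u -> alpha r u = alpha r' u) ->
  forall i k, m <= i -> r i k = r' i k.
Proof.
move=> rs i k mi.
(* Taking [t = i] makes every generator starting at [i] reach [t]. *)
have rs_i u : i <= u -> alpha r u = alpha r' u by move=> iu; apply: rs; lia.
have past := past_eq rs_i (leqnn l); rewrite subrK in past.
by apply: block_inj (block_glued rs_i past) _ _; lia.
Qed.

Lemma alpha_inj : injective (@alpha gT A l B).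
Proof.
move=> r r' rs; apply: functional_extensionality_dep => i.
apply: functional_extensionality_dep => k.
by apply: (tensor_eq_from (m := i)) => // u _; rewrite rs.
Qed.

(** * Surjectivity of [alpha] *)

Hypothesis ctrlA : controllable A l.

Lemma block_exists i x : Xsub A i x ->
  exists g : forall k : 'I_l.+1, set_type (B i k),
    Xsub A (i + 1) (x * (\prod_(k < l.+1) val (g k))^-1)%g.
Proof.
move=> Xx; have [|g Bg Xg] := gen_prod_exists (leqnn l.+1) Xx.
  (* Steering from [x] to the identity after time [i] takes [l] steps, which matches [n = l + 1]
     generators. *)
  have [z [Az zx z1]] := ctrlA (i + 1) Xx.1 mem_one.
  by exists z; split=> // s ls; apply: z1; lia.
exists (fun k : 'I_l.+1 => exist _ (g k) (mem_set (Bg k))).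
exact: Xg.
Qed.

Lemma alpha_surj_X m x : Xsub A m x -> exists r : tensor B, alpha r = x.
Proof.
move=> Xx.
pose ones i : forall k, set_type (B i k) :=
  fun k => exist _ 1%g (mem_set (basis_one B i k)).
(* [f] is total, with a default outside X^i, so the recursion for [xs] carries no membership
   proofs. *)
have f i y : {g : forall k : 'I_l.+1, set_type (B i k) | Xsub A i y ->
    Xsub A (i + 1) (y * (\prod_(k < l.+1) val (g k))^-1)%g}.
  apply: cid.
  have [/block_exists[g Xg]|nX] := pselect (Xsub A i y); first by exists g.
  by exists (ones i).
pose fix xs (p : nat) : bisequence gT := if p is p'.+1
  then (xs p' * (\prod_(k < l.+1) val (sval (f (m + p'%:Z)%R (xs p')) k))^-1)%g
  else x.
have xsX (p : nat) : Xsub A (m + p%:Z) (xs p).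
  elim: p => [|p IHp]; first by rewrite addr0.
  have -> : m + p.+1%:Z = m + p%:Z + 1 by lia.
  exact: svalP (f _ _) IHp.
pose r : tensor B := fun i => if m <= i then sval (f i (xs `|(i - m)%R|%N)) else ones i.
have xE (p : nat) : x = (xs p * assemble (before (m + p%:Z)%R (block r)))%g.
  elim: p => [|p {1}->].
    rewrite addr0 [assemble _](_ : _ = 1%g) ?mulg1//.
    apply: functional_extensionality_dep => t; apply: big1 => j _.
    rewrite /before; case: ifP => // mtj; rewrite /block bisequence_prodE.
    by apply: big1 => k _; rewrite /r mtj.
  have -> : m + p.+1%:Z = m + p%:Z + 1 by lia.
  rewrite assemble_before_succ; last exact: block_blocks.
  rewrite mulgA; congr (_ * _)%g; rewrite /=.
  have -> : block r (m + p%:Z) =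
      (\prod_(k < l.+1) val (sval (f (m + p%:Z)%R (xs p)) k))%g.
    rewrite /block /r ifT; last by lia.
    by have -> : `|(m + p%:Z - m)%R|%N = p by lia.
  by rewrite mulgKV.
exists r; rewrite alphaE; apply: functional_extensionality_dep => t.
(* Since [m + p > t], the remainder [xs p] and the blocks from [m + p] on vanish at [t]. *)
pose p := `|(t - m)%R|.+1.
rewrite (xE p) (assemble_split (m + p%:Z)) !bisequence_mulE.
by rewrite assemble_from_lt ?(xsX p).2//; lia.
Qed.

Lemma alpha_surj x : gs_set A x -> exists r : tensor B, alpha r = x.
Proof.
move=> Ax.
have r_ (n : nat) :
    {r : tensor B | forall u, - n%:Z <= u -> alpha r u = x u}.
  apply: cid.
  (* Starting the transition [l] steps early leaves [x] intact from [-n] on. *)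
  have [y [Ay y1 yx]] := ctrlA (- n%:Z - l%:Z) mem_one Ax.
  have [r ry] := alpha_surj_X (conj Ay y1).
  by exists r => u nu; rewrite ry yx//; lia.
have r_eq (n1 n2 : nat) i k :
    - n1%:Z <= i -> - n2%:Z <= i -> sval (r_ n1) i k = sval (r_ n2) i k.
  case: (r_ n1) (r_ n2) => [r1 r1x] [r2 r2x] /= n1i n2i.
  apply: (tensor_eq_from (m := i)) => // u iu.
  by rewrite r1x ?r2x//; lia.
exists (fun i => sval (r_ `|i|%N) i); apply: functional_extensionality_dep => t.
(* All blocks entering [alpha] at [t] start at or after [t - l >= -n], so the single tensor [r_ n]
   supplies them. *)
pose n := (`|t| + l)%N.
rewrite -(svalP (r_ n) t); last by rewrite /n; lia.
apply: eq_bigr => j _; apply: eq_bigr => k _.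
by rewrite (r_eq _ n)//; have := ltn_ord j; rewrite /n; lia.
Qed.

End Basis.

End Assembly.

End GroupSystem.

(** * Transport of the group law along [alpha] *)

Theorem theorem14 (gT : int -> finGroupType) (A : group_system gT) (l : nat)
    (l_gt0 : (0 < l)%N) (ctrlA : controllable A l) (complA : complete A)
    (B : basis A l) :
  [/\ forms_group (@tensor_mul gT A l B),
      set_bij [set: tensor B]%classic A (@alpha gT A l B) &
      forall r s : tensor B,
        alpha (tensor_mul r s) = (alpha r * alpha s)%g].
Proof.
have alphaA := alpha_mem complA (B := B).
have inj := alpha_inj complA (B := B).
have surj := alpha_surj B complA ctrlA.
have alphaM (r s : tensor B) : alpha (tensor_mul r s) = (alpha r * alpha s)%g.
  (* Surjectivity provides a solution, so [xget] does not return its default. *)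
  exact: (xgetPex r (surj _ (mem_mul (alphaA r) (alphaA s)))).
split=> //.
  have [e e1] := surj _ (mem_one A).
  have /choice[inv invE] (r : tensor B) : exists s : tensor B, alpha s = (alpha r)^-1%g.
    exact/surj/mem_inv.
  (* Each axiom is pulled back along the injection [alpha]. *)
  exists e, inv; split=> [r s u|r|r|r|r]; apply: inj; rewrite !alphaM ?invE ?e1.
  - exact: mulgA.
  - exact: mul1g.
  - exact: mulg1.
  - exact: mulVg.
  - exact: mulgV.
split=> [r _|r s _ _|x /surj[r <-]]; [exact: alphaA | exact: inj | by exists r].
Qed.
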